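(* Let $G$ be a countable discrete group. Then $G$ is amenable at infinity if and only if $G$ admits an amenable action by homeomorphisms on the Hilbert cube $I^{\aleph_0}=[0,1]^{\aleph_0}$.
   Context: For a countable discrete group $G$, $\mathcal{P}(G)$ denotes the space of probability measures on $G$ (identified with the functions $p:G\to[0,1]$ with $\sum_{h\in G}p(h)=1$, a subset of $\ell^1(G)$), equipped with the vague topology; $G$ acts on $\mathcal{P}(G)$ by left translation, $(gp)(h)=p(g^{-1}h)$, and $\|\cdot\|_1$ is the $\ell^1$-norm. An action of $G$ by homeomorphisms on a (nonempty) compact Hausdorff space $X$ is called amenable if there exists a sequence of continuous maps $b^n:X\to\mathcal{P}(G)$, $x\mapsto b^n_x$, such that for every $g\in G$, $\lim_{n\to\infty}\sup_{x\in X}\|g b^n_x-b^n_{gx}\|_1=0$. A countable discrete group $G$ is called amenable at infinity (or topologically amenable) if there exist a (nonempty) compact Hausdorff space $X$ and an amenable action of $G$ on $X$ by homeomorphisms. *)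

(* Defs.v *)
From HB Require Import structures.
From mathcomp Require Import all_boot all_order all_algebra.
From mathcomp Require Import all_classical all_reals all_analysis.

Set Implicit Arguments.
Unset Strict Implicit.
Unset Printing Implicit Defensive.

Import Order.TTheory GRing.Theory Num.Theory.
Import numFieldNormedType.Exports.

Local Open Scope classical_set_scope.
Local Open Scope ring_scope.

(* A (discrete) group is a [groupType]; its topology being discrete, it plays
   no role other than through the compactly supported functions below. *)

Record probability_on (R : realType) (G : groupType) := ProbabilityOn {
  mass :> G -> R ;
  mass_itv : forall h, 0 <= mass h <= 1 ;
  mass_sum : (\esum_(h in [set: G]) (mass h)%:E = 1)%E }.

HB.instance Definition _ (R : realType) (G : groupType) :=
  gen_eqMixin (probability_on R G).
HB.instance Definition _ (R : realType) (G : groupType) :=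
  gen_choiceMixin (probability_on R G).

(* C_c(G): on a discrete space every function is continuous, and the compact
   subsets are the finite ones. *)
Definition compactly_supported (R : realType) (G : groupType) : Type :=
  {f : G -> R | finite_set [set h | f h != 0]}.

(* The integral of f against p. The summation is that of [fsbigop], over the
   support of the summand, which is finite. *)
Definition pairing (R : realType) (G : groupType)
    (f : compactly_supported R G) (p : probability_on R G) : R :=
  \sum_(h \in [set: G]) sval f h * p h.

(* Vague topology: the coarsest one such that p |-> int f dp is continuous for
   every f in C_c(G). *)
Definition vague_topology (R : realType) (G : groupType) :=
  sup_topology (fun f : compactly_supported R G =>
    Topological.class (initial_topology (pairing f))).

HB.instance Definition _ (R : realType) (G : groupType) :=
  Topological.copy (probability_on R G) (vague_topology R G).

Definition left_translate (R : realType) (G : groupType) (g : G)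
    (p : G -> R) : G -> R :=
  fun h => p (g^-1 * h)%g.

Definition l1norm (R : realType) (G : groupType) (f : G -> R) : \bar R :=
  \esum_(h in [set: G]) `|f h|%:E.

Definition homeomorphism (X Y : topologicalType) (f : X -> Y) : Prop :=
  continuous f /\
  exists f' : Y -> X, [/\ continuous f', cancel f f' & cancel f' f].

Definition is_action_by_homeomorphisms (G : groupType) (X : topologicalType)
    (act : G -> X -> X) : Prop :=
  [/\ forall x, act 1%g x = x,
      forall g h x, act (g * h)%g x = act g (act h x)
    & forall g, homeomorphism (act g)].

Definition amenable_action (R : realType) (G : groupType) (X : topologicalType)
    (act : G -> X -> X) : Prop :=
  exists b : nat -> X -> probability_on R G,
    (forall n, continuous (b n)) /\
    forall g : G,
      ereal_sup [set l1norm (left_translate g (b n x) \- b n (act g x))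
                | x in [set: X]] @[n --> \oo] --> (0 : \bar R).

Definition admits_amenable_action (R : realType) (G : groupType)
    (X : topologicalType) : Prop :=
  exists act : G -> X -> X,
    is_action_by_homeomorphisms act /\ amenable_action R act.

Definition amenable_at_infinity (R : realType) (G : groupType) : Prop :=
  exists X : topologicalType,
    [/\ [set: X] !=set0, compact [set: X], hausdorff_space X
      & admits_amenable_action R G X].

(* The product of countably many copies of [0,1], each with its topology as a
   subspace of R. *)
Definition hilbert_cube (R : realType) : topologicalType :=
  prod_topology (fun _ : nat => set_type `[0 : R, 1]%classic).

(* Main.v *)
From HB Require Import structures.
Require Import Defs.
From mathcomp Require Import all_boot all_order all_algebra finmap.
From mathcomp Require Import all_classical all_reals all_analysis.
From mathcomp Require Import lra ring.

Local Open Scope classical_set_scope.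

Set Implicit Arguments.
Unset Strict Implicit.
Unset Printing Implicit Defensive.

Import Order.TTheory GRing.Theory Num.Theory.
Import numFieldNormedType.Exports.

Local Open Scope ring_scope.

(* Given an amenable action on X, fix x0 in X. By compactness the measures
   b^n_{x x0}, x in G, lie within 1/(n+1) of finitely many P^n_j, which defines
   a colouring c_n : G -> {0, ..., m_n - 1}. Encode x in G as the 0/1 sequence
   v_x indexed by (n, j, g) with v_x(n, j, g) = [c_n(g x) = j], and let Y be the
   set of real sequences lying, on every finite set of coordinates, within
   dl_(n,j,g) = del_n of some convex combination of the v_x. The group acts on Y
   by (h y)(n, j, g) = y(n, j, g h), and y |-> sum_j y(n, j, 1)^+ P^n_j,
   normalised, shows that this action is amenable as soon as m_n del_n -> 0.
   Moreover Y is a Hilbert cube, by an argument much simpler than Keller's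
   theorem: Y has polyhedral finite-dimensional projections, so when its
   coordinates are added one at a time, the fibre of each new coordinate is an
   interval whose endpoints depend continuously on the previous coordinates,
   and the thickening by del_n > 0 keeps this interval from degenerating. *)

Local Notation "R ^oo" := (prod_topology (fun _ : nat => (R : topologicalType)))
  (at level 2, format "R ^oo") : type_scope.

(** * Continuous maps into products and triangular coordinates *)

Lemma continuous_into_prod (X : topologicalType) (I : Type)
    (T : I -> topologicalType) (f : X -> prod_topology T) :
  (forall i, continuous (fun x => f x i)) -> continuous f.
Proof.
move=> cf x; apply/cvg_sup => i.
exact: (@continuous_comp_initial _ X (T i) (fun g : prod_topology T => g i)).
Qed.

Lemma continuous_coord (I : eqType) (T : I -> topologicalType) (i : I) :
  continuous (fun y : prod_topology T => y i).
Proof. exact: proj_continuous. Qed.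

Lemma continuous_into_subset (X Y : topologicalType) (A : set Y)
    (f : X -> A) : continuous (fun x => set_val (f x)) -> continuous f.
Proof. move=> cf; exact: (@continuous_comp_initial _ X Y set_val). Qed.

(** Retraction of the line onto [0,1]; with it the coordinate map [Phi] of [triangular_cube] is
    defined on all of [R ^oo]. *)
Definition clamp (R : realType) (t : R) : R := Num.max 0 (Num.min t 1).

Lemma clamp_itv (R : realType) (t : R) : clamp t \in `[0 : R, 1]%classic.
Proof.
by rewrite inE /= in_itv /= /clamp le_max lexx ge_max ler01 ge_min lexx orbT.
Qed.

Lemma clamp_id (R : realType) (t : R) : 0 <= t <= 1 -> clamp t = t.
Proof. by case/andP=> t0 t1; rewrite /clamp (min_l t1) (max_r t0). Qed.

Lemma continuous_maxr (R : realType) (T : topologicalType) (f g : T -> R) :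
  continuous f -> continuous g -> continuous (fun x => Num.max (f x) (g x)).
Proof. by move=> cf cg x; exact: (@continuous_max R T f g x (cf x) (cg x)). Qed.

Lemma continuous_minr (R : realType) (T : topologicalType) (f g : T -> R) :
  continuous f -> continuous g -> continuous (fun x => Num.min (f x) (g x)).
Proof. by move=> cf cg x; exact: (@continuous_min R T f g x (cf x) (cg x)). Qed.

Lemma continuous_addr (R : realType) (T : topologicalType) (f g : T -> R) :
  continuous f -> continuous g -> continuous (fun x => f x + g x).
Proof. by move=> cf cg x; exact: (@cvgD R R^o T _ _ f g _ _ (cf x) (cg x)). Qed.

Lemma continuous_sumr (R : realType) (T : topologicalType) (I : Type)
    (r : seq I) (F : I -> T -> R) :
  (forall i, continuous (F i)) -> continuous (fun x => \sum_(i <- r) F i x).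
Proof.
move=> cF; elim: r => [|i r IHr].
  rewrite (_ : (fun _ => _) = fun=> 0); first exact: cst_continuous.
  by apply: functional_extensionality_dep => x; rewrite big_nil.
rewrite (_ : (fun _ => _) = fun x => F i x + \sum_(j <- r) F j x).
  exact: continuous_addr.
by apply: functional_extensionality_dep => x; rewrite big_cons.
Qed.

Lemma continuous_subr (R : realType) (T : topologicalType) (f g : T -> R) :
  continuous f -> continuous g -> continuous (fun x => f x - g x).
Proof. by move=> cf cg x; exact: (@cvgB R R^o T _ _ f g _ _ (cf x) (cg x)). Qed.

Lemma continuous_mulr (R : realType) (T : topologicalType) (f g : T -> R) :
  continuous f -> continuous g -> continuous (fun x => f x * g x).
Proof. by move=> cf cg x; exact: (@cvgM R T _ _ f g _ _ (cf x) (cg x)). Qed.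

Lemma continuous_divr (R : realType) (T : topologicalType) (f g : T -> R) :
  continuous f -> continuous g -> (forall x, g x != 0) ->
  continuous (fun x => f x / g x).
Proof.
move=> cf cg g0; apply: continuous_mulr => // x.
exact: (@cvgV R T _ _ g _ (g0 x) (cg x)).
Qed.

Lemma continuous_compose (X Y Z : topologicalType) (f : X -> Y) (g : Y -> Z) :
  continuous f -> continuous g -> continuous (fun x => g (f x)).
Proof. by move=> cf cg x; apply: continuous_comp; [exact: cf | exact: cg]. Qed.

Lemma continuous_clamp (R : realType) : continuous (@clamp R).
Proof.
apply: continuous_maxr; first exact: cst_continuous.
by apply: continuous_minr; [move=> x; exact: cvg_id | exact: cst_continuous].
Qed.

(** Each value is a whole sequence so that [al m] and [be m] can be applied to it. The zeros from
    [n] on are placeholders, harmless when [al n] and [be n] look only at coordinates below [n]. *)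
Fixpoint cube_prefix (R : realType) (al be : nat -> R^oo -> R) (t : nat -> R)
    (n : nat) : R^oo :=
  if n is m.+1 then
    let y := cube_prefix al be t m in
    fun i => if i == m then al m y + t m * (be m y - al m y) else y i
  else fun=> 0.

Definition cube_point (R : realType) (al be : nat -> R^oo -> R)
    (t : nat -> R) : R^oo := fun n => cube_prefix al be t n.+1 n.

Lemma cube_prefixE (R : realType) (al be : nat -> R^oo -> R) t n i :
  (i < n)%N -> cube_prefix al be t n i = cube_point al be t i.
Proof.
elim: n => // n IHn; rewrite ltnS leq_eqVlt => /predU1P[->//|lin].
by rewrite /= ltn_eqF// IHn.
Qed.

(** The cube coordinate [n] is the relative position of [y n] between [al n y] and [be n y]. This
    interval depends on earlier coordinates only, so a point is recovered one coordinate at a time;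
    strictness in [albe] makes the quotient continuous everywhere. *)
Lemma triangular_cube (R : realType) (al be : nat -> R^oo -> R)
    (cal : forall n, continuous (al n)) (cbe : forall n, continuous (be n))
    (albe : forall n y, al n y < be n y)
    (alE : forall n y z, (forall i, (i < n)%N -> y i = z i) -> al n y = al n z)
    (beE : forall n y z, (forall i, (i < n)%N -> y i = z i) -> be n y = be n z) :
  exists (Phi : R^oo -> hilbert_cube R) (Psi : hilbert_cube R -> R^oo),
    [/\ continuous Phi, continuous Psi, cancel Psi Phi,
        forall q n, al n (Psi q) <= Psi q n <= be n (Psi q)
      & forall y, (forall n, al n y <= y n <= be n y) -> Psi (Phi y) = y].
Proof.
pose Psi (q : hilbert_cube R) : R^oo := cube_point al be (fun n => set_val (q n)).
pose rel n (y : R^oo) := (y n - al n y) / (be n y - al n y).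
pose Phi (y : R^oo) : hilbert_cube R := fun n => SigSub (clamp_itv (rel n y)).
have gap n y : 0 < be n y - al n y by rewrite subr_gt0.
have PsiE q n : Psi q n =
    al n (Psi q) + set_val (q n) * (be n (Psi q) - al n (Psi q)).
  rewrite {1}/Psi /cube_point /= eqxx.
  by rewrite !(@alE n _ (Psi q)) ?(@beE n _ (Psi q)) // => i /cube_prefixE ->.
have q01 (q : hilbert_cube R) n : 0 <= set_val (q n) <= (1 : R).
  by have := set_valP (q n); rewrite /= in_itv.
have relPsi q n : rel n (Psi q) = set_val (q n).
  rewrite /rel {1}PsiE [al _ _ + _]addrC addrK mulfK//.
  by rewrite gt_eqF.
exists Phi, Psi; split.
- apply: continuous_into_prod => n; apply: continuous_into_subset.
  apply: (@continuous_compose _ _ _ (rel n) (@clamp R)); last first.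
    exact: continuous_clamp.
  apply: continuous_divr => [||y]; last by rewrite gt_eqF.
    by apply: continuous_subr; [exact: continuous_coord | exact: cal].
  by apply: continuous_subr; [exact: cbe | exact: cal].
(* Coordinate [n] of [Psi q] is read off the prefix of length [n.+1], so continuity of [Psi] reduces
   to an induction on prefixes. *)
- have cpre n : continuous (fun q : hilbert_cube R =>
      cube_prefix al be (fun n => set_val (q n)) n : R^oo).
    elim: n => [|n IHn] /=; first exact: cst_continuous.
    apply: continuous_into_prod => i; case: eqP => _; last first.
      exact: (continuous_compose IHn (@continuous_coord _ _ i)).
    have ca := continuous_compose IHn (cal n).
    have cb := continuous_compose IHn (cbe n).
    apply: continuous_addr => //; apply: continuous_mulr.
      apply: (@continuous_compose _ (set_type `[0 : R, 1]%classic) R (fun q : hilbert_cube R => q n) set_val).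
        exact: continuous_coord.
      exact: initial_continuous.
    exact: continuous_subr.
  apply: continuous_into_prod => n.
  exact: (continuous_compose (cpre n.+1) (@continuous_coord _ _ n)).
- move=> q; apply: functional_extensionality_dep => n; apply: val_inj => /=.
  by rewrite relPsi clamp_id.
- move=> q n; have := q01 q n; have := gap n (Psi q); rewrite (PsiE q n).
  set t := set_val (q n); set d := be n _ - _ => d0 /andP[t0 t1].
  rewrite lerDl mulr_ge0 ?(ltW d0)//=.
  rewrite -lerBrDl -/d; rewrite -[leRHS]mul1r ler_wpM2r// ltW//.
- move=> y yP; suff yE n i : (i < n)%N -> Psi (Phi y) i = y i.
    by apply: functional_extensionality_dep => n; apply: (yE n.+1).
  elim: n i => // n IHn i; rewrite ltnS leq_eqVlt => /predU1P[->|]; last exact: IHn.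
  (* Both points agree below [n], hence have the same interval there; as [y n] lies in it, the clamp
     is inactive. *)
  rewrite PsiE (@alE n _ y)// (@beE n _ y)// set_valE /= clamp_id.
    by rewrite /rel divfK ?gt_eqF// addrC subrK.
  have /andP[h1 h2] := yP n.
  apply/andP; split; first by rewrite divr_ge0 ?subr_ge0// ltW.
  by rewrite ler_pdivrMr// mul1r lerD2r.
Qed.

(** * Polyhedral sets *)

(** Affinity is asked along lines only. The order of the quantifiers makes the slope [c] in
    direction [w] independent of the base point, which is what elimination of a variable uses. *)
Definition affine_fun (R : realType) (f : R^oo -> R) : Prop :=
  continuous f /\ forall w, exists c, forall z t,
    f (fun i => z i + t * w i) = f z + t * c.

Definition slope (R : realType) (w : R^oo) (f : R^oo -> R) : R :=
  f w - f (fun=> 0).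

Lemma affine_slope (R : realType) (f : R^oo -> R) (w z : R^oo) (t : R) :
  affine_fun f -> f (fun i => z i + t * w i) = f z + t * slope w f.
Proof.
case=> _ /(_ w) [c fc]; rewrite fc /slope; congr (_ + _ * _).
rewrite (_ : w = fun i => (fun=> 0) i + 1 * w i); first by rewrite fc; lra.
by apply: functional_extensionality_dep => i; rewrite add0r mul1r.
Qed.

Lemma affine_cst (R : realType) (a : R) : affine_fun (fun=> a).
Proof.
split; first exact: cst_continuous.
by move=> w; exists 0 => z t; rewrite mulr0 addr0.
Qed.

Lemma affine_coord (R : realType) (i : nat) : affine_fun (fun z : R^oo => z i).
Proof. by split; [exact: continuous_coord | move=> w; exists (w i)]. Qed.

Lemma affine_comb (R : realType) (a b : R) (f g : R^oo -> R) :
  affine_fun f -> affine_fun g -> affine_fun (fun z => a * f z + b * g z).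
Proof.
move=> [cf sf] [cg sg]; split.
  by apply: continuous_addr; apply: continuous_mulr => //; exact: cst_continuous.
move=> w; have [c fc] := sf w; have [d gd] := sg w.
by exists (a * c + b * d) => z t; rewrite fc gd; ring.
Qed.

Definition polyhedral (R : realType) (P : R^oo -> Prop) : Prop :=
  exists L : seq (R^oo -> R), (forall f, List.In f L -> affine_fun f) /\
    forall z, P z <-> forall f, List.In f L -> f z <= 0.

Lemma polyhedral_and (R : realType) (P Q : R^oo -> Prop) :
  polyhedral P -> polyhedral Q -> polyhedral (fun z => P z /\ Q z).
Proof.
move=> [L [La LP]] [M [Ma MQ]]; exists (L ++ M); split.
  by move=> f /List.in_app_iff[/La|/Ma].
move=> z; rewrite LP MQ; split => [[hL hM] f /List.in_app_iff[/hL|/hM]//|h].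
by split=> f fin; apply: h; apply/List.in_app_iff; [left | right].
Qed.

Lemma polyhedral_halfspace (R : realType) (f : R^oo -> R) :
  affine_fun f -> polyhedral (fun z => f z <= 0).
Proof.
move=> fa; exists [:: f]; split; first by move=> g [<-|[]].
by move=> z; split=> [fz g [<-|[]]//|]; apply; left.
Qed.

Lemma polyhedral_iff (R : realType) (P Q : R^oo -> Prop) :
  (forall z, P z <-> Q z) -> polyhedral P -> polyhedral Q.
Proof. by move=> PQ [L [La LP]]; exists L; split=> // z; rewrite -PQ. Qed.

(** Used to pick the least [t >= 0] above finitely many lower bounds; the last clause says which
    constraint is tight. *)
Lemma max_of_list (R : realType) (s : seq R) :
  exists t, [/\ 0 <= t, forall a, List.In a s -> a <= t & t = 0 \/ List.In t s].
Proof.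
elim: s => [|a s [t [t0 tmax tin]]]; first by exists 0; split=> //; left.
have [ta|/ltW at_] := lerP a t.
  exists t; split=> // [b [<-//|/tmax//]|].
  by case: tin => [->|?]; [left | right; right].
exists a; split; first exact: le_trans at_.
  by move=> b [<-//|/tmax/le_trans]; apply.
by right; left.
Qed.

(* Fourier-Motzkin elimination of the variable [t]. *)
Lemma polyhedral_ray (R : realType) (P : R^oo -> Prop) (w : R^oo) :
  polyhedral P ->
  polyhedral (fun z => exists t, 0 <= t /\ P (fun i => z i - t * w i)).
Proof.
move=> [L [La LP]].
pose c f := slope w f.
(* A constraint becomes [f z - t * c f <= 0], a lower bound on [t] if [c f > 0] and an upper bound
   if [c f < 0]. [A] confronts the upper bounds with [0 <= t] and keeps the constraints free of [t];
   [B] confronts each lower bound with each upper bound. The zero function stands for the cases that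
   impose nothing. *)
pose A f : R^oo -> R := if c f <= 0 then f else fun=> 0.
pose B (fg : (R^oo -> R) * (R^oo -> R)) : R^oo -> R :=
  if (0 < c fg.1) && (c fg.2 < 0)
  then fun z => c fg.1 * fg.2 z + (- c fg.2) * fg.1 z else fun=> 0.
have shiftE f z t : List.In f L ->
    f (fun i => z i - t * w i) = f z - t * c f.
  move=> /La fa; rewrite -mulNr -(affine_slope w z (- t) fa).
  by congr f; apply: functional_extensionality_dep => i; rewrite mulNr.
exists (List.map A L ++ List.map B (List.list_prod L L)); split.
  move=> f /List.in_app_iff[] /List.in_map_iff.
    case=> g [<- /La ga]; rewrite /A; case: ifP => // _; exact: affine_cst.
  case=> -[g h] [<- /List.in_prod_iff[/La ga /La ha]]; rewrite /B.
  by case: ifP => _; [exact: affine_comb | exact: affine_cst].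
move=> z; split.
  move=> [t [t0 /LP Pt]] f /List.in_app_iff[] /List.in_map_iff.
    case=> g [<- gL]; rewrite /A; case: ifP => // cg.
    by have := Pt g gL; rewrite shiftE//; nra.
  case=> -[g h] [<- /List.in_prod_iff[gL hL]]; rewrite /B /=.
  case: ifP => // /andP[cg ch].
  by have := Pt g gL; have := Pt h hL; rewrite !shiftE//; nra.
move=> h.
have hA f : List.In f L -> c f <= 0 -> f z <= 0.
  move=> fL cf; have := h (A f); rewrite /A cf; apply.
  apply/List.in_app_iff; left; apply/List.in_map_iff; exists f.
  by rewrite /A cf.
have hB f g : List.In f L -> List.In g L -> 0 < c f -> c g < 0 ->
    c f * g z - c g * f z <= 0.
  move=> fL gL cf cg; have := h (B (f, g)); rewrite /B /= cf cg /= mulNr; apply.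
  apply/List.in_app_iff; right; apply/List.in_map_iff; exists (f, g).
  by rewrite /B /= cf cg /=; split=> //; apply/List.in_prod_iff.
(* The witness is the largest lower bound, or 0: if any [t] works, this one does. *)
pose lows := List.map (fun f => f z / c f) (List.filter (fun f => 0 < c f) L).
have [t [t0 tmax tin]] := max_of_list lows.
exists t; split=> //; apply/LP => f fL; rewrite shiftE// subr_le0.
have [cf|cf|cf] := ltrgtP (c f) 0; last by rewrite cf mulr0 hA// cf.
  case: tin => [->|/List.in_map_iff[g [<- /List.filter_In[gL cg]]]].
    by rewrite mul0r hA// ltW.
  have := hB g f gL fL cg cf.
  by rewrite mulrAC ler_pdivlMr//; lra.
rewrite -ler_pdivrMr//; apply: tmax; apply/List.in_map_iff; exists f; split=> //.
by apply/List.filter_In.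
Qed.

(** Each constraint of nonzero slope bounds [t] by a continuous function of [z], so [al] is a finite
    maximum and [be] a finite minimum, started at [lo] and [hi] in case a side has no constraint.
    Constraints of zero slope do not involve [t]; they hold on the whole line as soon as the fibre
    is nonempty. *)
Lemma polyhedral_fiber (R : realType) (P : R^oo -> Prop) (w : R^oo) (lo hi : R) :
  polyhedral P ->
  exists al be : R^oo -> R, [/\ continuous al, continuous be &
    forall z, (exists t, P (fun i => z i + t * w i)) ->
      (forall t, P (fun i => z i + t * w i) -> lo <= t <= hi) ->
      forall t, P (fun i => z i + t * w i) <-> al z <= t <= be z].
Proof.
move=> [L [La LP]].
have [al [be [ca cb abP]]] : exists al be : R^oo -> R,
    [/\ continuous al, continuous be & forall z t, al z <= t <= be z <->
      lo <= t <= hi /\ forall f, List.In f L -> slope w f != 0 ->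
        f z + t * slope w f <= 0].
  elim: L La {LP} => [|f L IHL] La.
    exists (fun=> lo), (fun=> hi); split; [exact: cst_continuous..|].
    by move=> z t; split=> [h|[]//]; split.
  have [|al [be [ca cb abP]]] := IHL; first by move=> g gL; apply: La; right.
  have [cf sf] : affine_fun f by apply: La; left.
  have cfs a : continuous (fun z : R^oo => f z * a).
    by apply: continuous_mulr => //; exact: cst_continuous.
  have [sl|sl|sl] := ltrgtP (slope w f) 0.
  - exists (fun z => Num.max (f z * (- (slope w f)^-1)) (al z)), be; split=> //.
      exact: continuous_maxr.
    move=> z t; rewrite ge_max -andbA.
    have -> : (f z * - (slope w f)^-1 <= t) = (f z + t * slope w f <= 0).
      rewrite -invrN ler_pdivrMr ?oppr_gt0// mulrN.
      by rewrite -subr_le0 opprK.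
    split=> [/andP[h1 /abP[h2 h3]]|[h1 h2]].
      by split=> // g [<-//|]; exact: h3.
    apply/andP; split; first by apply: h2; [left | rewrite lt_eqF].
    by apply/abP; split=> // g gL; apply: h2; right.
  - exists al, (fun z => Num.min (f z * (- (slope w f)^-1)) (be z)); split=> //.
      exact: continuous_minr.
    move=> z t; rewrite le_min andbCA.
    have -> : (t <= f z * - (slope w f)^-1) = (f z + t * slope w f <= 0).
      rewrite mulrN -mulNr ler_pdivlMr//.
      by rewrite -[in RHS](opprK (f z)) addrC subr_le0.
    split=> [/andP[h1 /abP[h2 h3]]|[h1 h2]].
      by split=> // g [<-//|]; exact: h3.
    apply/andP; split; first by apply: h2; [left | rewrite gt_eqF].
    by apply/abP; split=> // g gL; apply: h2; right.
  - exists al, be; split=> // z t; rewrite abP.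
    split=> -[h1 h2]; split=> // g; last by move=> gL; apply: h2; right.
    by case=> [<-|]; [rewrite sl eqxx | exact: h2].
exists al, be; split=> // z [t0 Pt0] bnd t; rewrite abP; split.
  move=> Pt; split; first exact: bnd.
  move=> f fL _; rewrite -affine_slope; last exact: La.
  by move/LP: Pt; apply.
move=> [_ h]; apply/LP => f fL; rewrite affine_slope; last exact: La.
have [s0|] := eqVneq (slope w f) 0; last exact: h.
move/LP: Pt0 => /(_ f fL); rewrite affine_slope; last exact: La.
by rewrite s0 !mulr0.
Qed.

(** * Thickened convex hulls of 0/1 sequences *)

(** The list [l] is a finite convex combination of the [v x]. It may change with [n], so the
    condition for all [n] does not ask for one combination good on all coordinates. *)
Definition near_hull (R : realType) (T : Type) (v : T -> nat -> bool)
    (dl : nat -> R) (n : nat) (y : R^oo) : Prop :=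
  exists l : seq (T * R),
    [/\ all (fun p => 0 <= p.2) l, \sum_(p <- l) p.2 = 1
      & forall i, (i < n)%N ->
          `|y i - \sum_(p <- l) p.2 * (v p.1 i)%:R| <= dl i].

Definition homogenize (R : realType) (y : R^oo) (t : R) : R^oo :=
  fun i => if i is j.+1 then y j else t.

(* Coordinate 0 records the total weight, so that a thickened convex hull
   becomes the slice at height 1 of a cone. *)
Fixpoint cone (R : realType) (T : Type) (v : T -> nat -> bool)
    (dl : nat -> R) (n : nat) (xs : seq T) (z : R^oo) : Prop :=
  if xs is x :: xs' then
    exists t, 0 <= t /\
      cone v dl n xs' (fun i => z i - t * homogenize (fun j => (v x j)%:R) 1 i)
  else z 0%N = 0 /\ forall i, (i < n)%N -> `|z i.+1| <= dl i.

Section Cone.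
Variables (R : realType) (T : eqType) (v : T -> nat -> bool) (dl : nat -> R).

(** The base is a box in the hyperplane of weight 0, and every point of [xs] adds one ray, hence one
    elimination. *)
Lemma polyhedral_cone n (xs : seq T) : polyhedral (cone v dl n xs).
Proof.
elim: xs => [|x xs IHxs] /=; last exact: polyhedral_ray.
apply: polyhedral_and.
  apply: (@polyhedral_iff _ (fun z => z 0%N <= 0 /\ 0 * z 0%N + (-1) * z 0%N <= 0)).
    by move=> z; split=> [[? ?]|->]; lra.
  apply: polyhedral_and; apply: polyhedral_halfspace; first exact: affine_coord.
  by apply: affine_comb; exact: affine_coord.
elim: n => [|n IHn].
  by exists [::]; split=> // z; split.
apply: (@polyhedral_iff _ (fun z =>
  (forall i, (i < n)%N -> `|z i.+1| <= dl i) /\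
  (1 * z n.+1 + (-1) * dl n <= 0 /\ (-1) * z n.+1 + (-1) * dl n <= 0))).
  move=> z; split=> [[h [h1 h2]] i|h].
    rewrite ltnS leq_eqVlt => /predU1P[->|/h//].
    by rewrite ler_norml; lra.
  have := h n (ltnSn n); rewrite ler_norml => hn.
  by split=> [i lin|]; [apply: h; rewrite ltnS ltnW | lra].
apply: polyhedral_and => //; apply: polyhedral_and;
  by apply/polyhedral_halfspace/affine_comb; [exact: affine_coord | exact: affine_cst].
Qed.

Lemma cone_ext n (xs : seq T) (z z' : R^oo) :
  (forall i, (i <= n)%N -> z i = z' i) -> cone v dl n xs z -> cone v dl n xs z'.
Proof.
elim: xs z z' => [|x xs IHxs] z z' zz' /=.
  by move=> [z0 h]; rewrite -zz'//; split=> // i lin; rewrite -zz'//; exact: h.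
move=> [t [t0 h]]; exists t; split=> //; apply: IHxs h => i lin.
by rewrite zz'.
Qed.

Lemma cone_add n (xs : seq T) (x : T) (s : R) (z : R^oo) :
  List.In x xs -> 0 <= s -> cone v dl n xs z ->
  cone v dl n xs (fun i => z i + s * homogenize (fun j => (v x j)%:R) 1 i).
Proof.
move=> + s0; elim: xs z => [//|x' xs IHxs] z [->|xin] /= [t [t0 h]].
  exists (t + s); split; first exact: addr_ge0.
  by apply: cone_ext h => i _; ring.
exists t; split=> //; apply: cone_ext (IHxs _ xin h) => i _; ring.
Qed.

Lemma cone_box n (xs : seq T) (z : R^oo) :
  z 0%N = 0 -> (forall i, (i < n)%N -> `|z i.+1| <= dl i) -> cone v dl n xs z.
Proof.
move=> z0 zi; elim: xs => [//|x xs IHxs] /=; exists 0; split=> //.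
by apply: cone_ext IHxs => i _; rewrite mul0r subr0.
Qed.

(** Every point of a combination can be replaced by its representative in [xs], and weights landing
    on the same representative add up. Conversely the successive parameters [t] of the cone are the
    weights. *)
Lemma near_hull_cone n (xs : seq T) (y : R^oo) :
  (forall x, exists2 x', List.In x' xs & forall i, (i < n)%N -> v x i = v x' i) ->
  near_hull v dl n y <-> cone v dl n xs (homogenize y 1).
Proof.
move=> rep; split=> [[l [l0 l1 ly]]|].
  (* The error [u] is frozen while the weighted points are added one by one to the box. *)
  pose u := fun j => y j - \sum_(p <- l) p.2 * (v p.1 j)%:R.
  suff: cone v dl n xs (homogenize (fun j =>
      u j + \sum_(p <- l) p.2 * (v p.1 j)%:R) (\sum_(p <- l) p.2)).
    by apply: cone_ext => -[|i] _ //=; rewrite /u subrK.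
  have {ly} : forall i, (i < n)%N -> `|u i| <= dl i by [].
  move: u; elim: l l0 {l1} => [|p l IHl] + u udl /=.
    by move=> _; apply: cone_box => [|i lin] /=; rewrite big_nil ?addr0// udl.
  move=> /andP[p0 l0]; have [x' x'in x'P] := rep p.1.
  apply: cone_ext (cone_add x'in p0 (IHl l0 u udl)) => -[|i] lin /=.
    by rewrite big_cons mulr1 addrC.
  by rewrite big_cons x'P//; ring.
(* Removing a ray lowers the total weight, so the induction needs an arbitrary weight [z 0] in place
   of 1. *)
suff gen z : cone v dl n xs z -> exists l : seq (T * R),
    [/\ all (fun p => 0 <= p.2) l, \sum_(p <- l) p.2 = z 0%N
      & forall i, (i < n)%N ->
          `|z i.+1 - \sum_(p <- l) p.2 * (v p.1 i)%:R| <= dl i].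
  by move=> /gen.
elim: xs {rep} z => [|x xs IHxs] z /=.
  move=> [z0 h]; exists [::]; split=> //; first by rewrite big_nil.
  by move=> i lin; rewrite big_nil subr0 h.
move=> [t [t0 /IHxs[l [l0 l1 lz]]]]; exists ((x, t) :: l); split=> /=.
- by rewrite t0.
- by rewrite big_cons l1 /=; ring.
- move=> i /lz /=; rewrite big_cons /=; apply: le_trans.
  by rewrite opprD addrA.
Qed.

(** Only finitely many 0/1 words of length [n] exist, and one point is kept for each word attained.
    This makes the hull of a possibly infinite family polyhedral. *)
Lemma finite_patterns n : exists xs : seq T,
  forall x, exists2 x', List.In x' xs & forall i, (i < n)%N -> v x i = v x' i.
Proof.
pose pat x := [ffun i : 'I_n => v x i].
suff gen : forall s : seq {ffun 'I_n -> bool}, exists xs : seq T,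
    forall x, pat x \in s -> exists2 x', List.In x' xs & pat x = pat x'.
  have [xs xsP] := gen (enum {ffun 'I_n -> bool}).
  exists xs => x; have [|x' x'in /ffunP pxx'] := xsP x; first by rewrite mem_enum.
  exists x' => // i lin.
  by have := pxx' (Ordinal lin); rewrite !ffunE.
elim=> [|r s [xs xsP]]; first by exists [::].
have [[x0 x0r]|nr] := pselect (exists x0, pat x0 = r).
  exists (x0 :: xs) => x; rewrite inE => /predU1P[xr|/xsP[x' ? ?]].
    by exists x0; [left | rewrite xr].
  by exists x' => //; right.
exists xs => x; rewrite inE => /predU1P[xr|/xsP//].
by case: nr; exists x.
Qed.

Lemma polyhedral_near_hull n : polyhedral (near_hull v dl n).
Proof.
have [xs rep] := finite_patterns n.
apply: (@polyhedral_iff _ (fun y => cone v dl n xs (homogenize y 1))).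
  by move=> y; apply: iff_sym; exact: near_hull_cone.
have [L [La LP]] := polyhedral_cone n xs.
exists (List.map (fun f y => f (homogenize y 1)) L); split.
  move=> f /List.in_map_iff[g [<- /La [cg sg]]]; split.
    apply: continuous_compose cg; apply: continuous_into_prod => -[|i].
      exact: cst_continuous.
    exact: continuous_coord.
  (* Moving inside the slice keeps the weight equal to 1, so the direction [w] is lifted with weight
     0. *)
  move=> w; have [c gc] := sg (homogenize w 0); exists c => z t.
  rewrite -gc; congr g; apply: functional_extensionality_dep => -[|i] //=.
  by rewrite mulr0 addr0.
move=> y; rewrite LP; split=> [h f /List.in_map_iff[g [<-]]|h f fL]; first exact: h.
by apply: (h (fun y => f (homogenize y 1))); apply/List.in_map_iff; exists f.
Qed.

Lemma near_hull_ext n (y y' : R^oo) :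
  (forall i, (i < n)%N -> y i = y' i) ->
  near_hull v dl n y -> near_hull v dl n y'.
Proof.
move=> yy' [l [l0 l1 ly]]; exists l; split=> // i lin.
by rewrite -yy' //; exact: ly.
Qed.

(** A convex combination of 0/1 values lies in [0,1]. This supplies the bounds [lo] and [hi] of
    [polyhedral_fiber]. *)
Lemma near_hull_bound n (y : R^oo) :
  near_hull v dl n.+1 y -> - dl n <= y n <= 1 + dl n.
Proof.
move=> [l [l0 l1 /(_ n (ltnSn n))]]; rewrite ler_norml.
set s := \sum_(p <- l) _ => h.
have s0 : 0 <= s.
  rewrite /s big_seq; apply: sumr_ge0 => p pl.
  by rewrite mulr_ge0 ?ler0n//; exact: (allP l0).
have s1 : s <= 1.
  rewrite -l1 /s big_seq [leRHS]big_seq; apply: ler_sum => p pl.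
  by rewrite ler_piMr//; [exact: (allP l0) | case: (v _ _)].
lra.
Qed.

(** The combination that serves for [n] coordinates serves for one more, [m] being its value
    there. *)
Lemma near_hull_extend n (y : R^oo) : near_hull v dl n y ->
  exists m, forall y', (forall i, (i < n)%N -> y i = y' i) ->
    `|y' n - m| <= dl n -> near_hull v dl n.+1 y'.
Proof.
move=> [l [l0 l1 ly]]; exists (\sum_(p <- l) p.2 * (v p.1 n)%:R) => y' yy' y'n.
exists l; split=> // i; rewrite ltnS leq_eqVlt => /predU1P[->//|lin].
by rewrite -yy'//; exact: ly.
Qed.

End Cone.

(* Over a point near the hull in its first n coordinates, the admissible values
   of coordinate n form an interval of length at least [2 * dl n], by
   [near_hull_extend]. The maximum in [be] is inactive there; it only ensures
   [al < be] everywhere. *)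
Lemma near_hull_cube (R : realType) (T : eqType) (x0 : T) (v : T -> nat -> bool)
    (dl : nat -> R) (dl0 : forall n, 0 < dl n) :
  exists (Phi : R^oo -> hilbert_cube R) (Psi : hilbert_cube R -> R^oo),
    [/\ continuous Phi, continuous Psi, cancel Psi Phi,
        forall q n, near_hull v dl n (Psi q)
      & forall y, (forall n, near_hull v dl n y) -> Psi (Phi y) = y].
Proof.
(* Composing the fibre bounds with [trunc n] forces them to depend on the coordinates below [n]
   only, as [triangular_cube] demands. *)
pose trunc n (y : R^oo) : R^oo := fun i => if (i < n)%N then y i else 0.
pose e n : R^oo := fun i => (i == n)%:R.
have truncE n y i : (i < n)%N -> trunc n y i = y i by rewrite /trunc => ->.
have ctrunc n : continuous (trunc n).
  apply: continuous_into_prod => i; rewrite /trunc.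
  by case: ltnP => _; [exact: continuous_coord | exact: cst_continuous].
have ab n : { ab : (R^oo -> R) * (R^oo -> R) |
    [/\ continuous ab.1, continuous ab.2 &
    forall z, (exists t, near_hull v dl n.+1 (fun i => z i + t * e n i)) ->
      forall t, near_hull v dl n.+1 (fun i => z (i : nat) + t * e n i) <->
        ab.1 (trunc n z) <= z n + t <= ab.2 (trunc n z)]}.
  apply: cid.
  have [al [be [ca cb abP]]] := polyhedral_fiber (e n) (- dl n) (1 + dl n)
    (polyhedral_near_hull v dl n.+1).
  exists (al, be); split=> //= z [t0 h0] t.
  (* With coordinate [n] of the base point reset to 0, the parameter on the line is the value of
     that coordinate itself. *)
  have E s i : (i < n.+1)%N ->
      z i + s * e n i = trunc n z i + (z n + s) * e n i.
    rewrite ltnS leq_eqVlt /trunc /e => /predU1P[->|lin].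
      by rewrite ltnn eqxx !mulr1 add0r.
    by rewrite lin ltn_eqF// !mulr0.
  have iffE s : near_hull v dl n.+1 (fun i => z i + s * e n i) <->
      near_hull v dl n.+1 (fun i => trunc n z i + (z n + s) * e n i).
    by split; apply: near_hull_ext => i /E.
  rewrite iffE abP//; first by exists (z n + t0); apply/iffE.
  by move=> s /near_hull_bound; rewrite /trunc /e ltnn eqxx add0r mulr1.
pose al n := fun y => (sval (ab n)).1 (trunc n y).
pose be n := fun y => Num.max ((sval (ab n)).2 (trunc n y)) (al n y + dl n).
have alE n y z : (forall i, (i < n)%N -> y i = z i) -> trunc n y = trunc n z.
  move=> yz; apply: functional_extensionality_dep => i.
  by rewrite /trunc; case: ltnP => // /yz.
have step n y : near_hull v dl n y ->
    near_hull v dl n.+1 y <-> al n y <= y n <= be n y.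
  move=> ny; have [m mP] := near_hull_extend ny.
  rewrite /be /al; case: (ab n) => -[a b] [_ _ /= abP].
  have ext t : `|y n + t - m| <= dl n ->
      near_hull v dl n.+1 (fun i => y i + t * e n i).
    move=> h; apply: mP => [i lin|]; rewrite /e; first by rewrite ltn_eqF// mulr0 addr0.
    by rewrite eqxx mulr1.
  have ex : exists t, near_hull v dl n.+1 (fun i => y i + t * e n i).
    by exists (m - y n); apply: ext; rewrite addrCA subrr addr0 subrr normr0 ltW.
  have {}abP := abP y ex.
  (* Both [m - dl n] and [m + dl n] are admissible, so the maximum in [be] is its first argument. *)
  have /abP h1 : near_hull v dl n.+1 (fun i => y i + (m - dl n - y n) * e n i).
    by apply: ext; have := dl0 n; rewrite ler_norml; lra.
  have /abP h2 : near_hull v dl n.+1 (fun i => y i + (m + dl n - y n) * e n i).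
    by apply: ext; have := dl0 n; rewrite ler_norml; lra.
  rewrite max_l; last by have := dl0 n; lra.
  rewrite -[y n]addr0 -abP; split; apply: near_hull_ext => i _; rewrite mul0r addr0//.
have cal n : continuous (al n).
  rewrite /al; case: (ab n) => -[a b] [/= ca _ _].
  exact: (continuous_compose (ctrunc n) ca).
have cbe n : continuous (be n).
  apply: continuous_maxr.
    case: (ab n) => -[a b] [/= _ cb _].
    exact: (continuous_compose (ctrunc n) cb).
  by apply: continuous_addr => //; exact: cst_continuous.
have hullP y : (forall n, near_hull v dl n y) <->
    (forall n, al n y <= y n <= be n y).
  split=> [h n|h]; first exact/step.
  elim=> [|n IHn]; last exact/step.
  (* For [n = 0] no coordinate is constrained, yet weights of sum 1 are required: the unit mass at
     [x0] provides them. *)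
  exists [:: (x0, 1)]; split=> //=; first by rewrite ler01.
  by rewrite big_seq1.
have [|||Phi [Psi [cPhi cPsi PsiK PsiP PhiK]]] := triangular_cube cal cbe.
- by move=> n y; rewrite lt_max [al n y < _ + _]ltrDl dl0 orbT.
- by move=> n y z /alE; rewrite /al => ->.
- by move=> n y z /alE; rewrite /be /al => ->.
exists Phi, Psi; split=> // [q|y /hullP /PhiK//].
exact/hullP.
Qed.

(** * Probability measures in the l1 norm *)

(** A bound on all finite partial sums; it keeps the estimates in [R], away from extended reals and
    summability. *)
Definition l1_le (R : realType) (G : eqType) (f : G -> R) (B : R) : Prop :=
  forall s : seq G, uniq s -> \sum_(h <- s) `|f h| <= B.

Lemma l1norm_leP (R : realType) (G : groupType) (f : G -> R) (B : R) :
  (l1norm f <= B%:E)%E <-> l1_le f B.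
Proof.
split=> [fB s us|fB].
  rewrite -lee_fin; apply: le_trans fB; apply: ereal_sup_ubound.
  exists [set` s]; first by split=> //; exact: finite_seq.
  rewrite fsbig_finite /=; last exact: finite_seq.
  rewrite -sumEFin; apply: perm_big; apply: uniq_perm; rewrite ?fset_uniq//.
  move=> x; rewrite in_fset_set; last exact: finite_seq.
  by apply/idP/idP => [/set_mem|xs]; last exact/mem_set.
apply: ge_ereal_sup => _ [A [finA _] <-].
by rewrite fsbig_finite//= sumEFin lee_fin; apply: fB; exact: fset_uniq.
Qed.

Section L1.
Variables (R : realType) (G : eqType).
Implicit Types (f g : G -> R) (B C : R) (s : seq G).

Lemma l1_le_trans f B C : B <= C -> l1_le f B -> l1_le f C.
Proof. by move=> BC fB s us; exact: le_trans (fB s us) BC. Qed.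

Lemma l1_leB f g k B C : l1_le (f \- g) B -> l1_le (g \- k) C ->
  l1_le (f \- k) (B + C).
Proof.
move=> fB gC s us; apply: le_trans (lerD (fB s us) (gC s us)).
rewrite -big_split /=; apply: ler_sum => h _.
by apply: le_trans (ler_normD _ _); rewrite addrA subrK.
Qed.

Lemma l1_leC f g B : l1_le (f \- g) B -> l1_le (g \- f) B.
Proof.
by move=> fB s us; under eq_bigr do rewrite /= distrC; exact: fB.
Qed.

Lemma l1_le_sum (I : eqType) (r : seq I) (c : I -> R) (F : I -> G -> R) (B : I -> R) :
  (forall i, i \in r -> l1_le (F i) (B i)) ->
  l1_le (fun h => \sum_(i <- r) c i * F i h) (\sum_(i <- r) `|c i| * B i).
Proof.
move=> FB s us; apply: (@le_trans _ _
    (\sum_(i <- r) \sum_(h <- s) `|c i| * `|F i h|)).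
  rewrite exchange_big; apply: ler_sum => h _.
  apply: le_trans (ler_norm_sum _ _ _) _.
  by apply: ler_sum => i _; rewrite normrM.
rewrite big_seq [leRHS]big_seq; apply: ler_sum => i ir.
by rewrite -mulr_sumr ler_wpM2l// FB.
Qed.

Lemma sum_sub_seq f (s t : seq G) :
  (forall h, 0 <= f h) -> uniq s -> uniq t -> {subset s <= t} ->
  \sum_(h <- s) f h <= \sum_(h <- t) f h.
Proof.
move=> f0 us ut st; rewrite [leRHS](bigID (mem s)) /= -[in leRHS]big_filter.
rewrite (@perm_big _ _ _ _ [seq h <- t | h \in s] s) /=; last first.
  apply: uniq_perm; rewrite ?filter_uniq// => h.
  by rewrite mem_filter andb_idr//; exact: st.
by rewrite lerDl; apply: sumr_ge0.
Qed.

(** Outside [s] the function [f] has mass at most [e], hence [g] at most [2 * e], since [g] loses at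
    most [e] on [s]. With the difference on [s] this adds up to [4 * e]. *)
Lemma l1_le_of_finite f g s (e : R) :
  (forall h, 0 <= f h) -> (forall h, 0 <= g h) -> l1_le f 1 -> l1_le g 1 ->
  uniq s -> 1 - e <= \sum_(h <- s) f h -> \sum_(h <- s) `|g h - f h| <= e ->
  l1_le (g \- f) (4 * e).
Proof.
move=> f0 g0 f1 g1 us fs gfs t ut.
pose d := [seq h <- t | h \notin s].
have usd : uniq (s ++ d).
  rewrite cat_uniq us filter_uniq// andbT /=.
  by apply/hasPn => h; rewrite mem_filter => /andP[].
apply: (@le_trans _ _ (\sum_(h <- s ++ d) `|g h - f h|)).
  apply: (@sum_sub_seq (fun h => `|g h - f h|)) => // h ht.
  by rewrite mem_cat mem_filter ht andbT; case: (h \in s).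
have tl (k : G -> R) : (forall h, 0 <= k h) -> l1_le k 1 ->
    \sum_(h <- d) k h <= 1 - \sum_(h <- s) k h.
  move=> k0 /(_ _ usd); under eq_bigr do rewrite ger0_norm//.
  by rewrite big_cat /= => H; lra.
have fd := tl _ f0 f1; have gd := tl _ g0 g1.
have gs : \sum_(h <- s) f h - \sum_(h <- s) g h <= e.
  rewrite -sumrB; apply: le_trans gfs; apply: ler_sum => h _.
  by rewrite distrC ler_norm.
have dd : \sum_(h <- d) `|g h - f h| <= \sum_(h <- d) g h + \sum_(h <- d) f h.
  rewrite -big_split /=; apply: ler_sum => h _.
  by apply: le_trans (ler_normB _ _) _; rewrite !ger0_norm.
rewrite big_cat /=; lra.
Qed.

End L1.

Section Probability.
Variables (R : realType) (G : groupType).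
Implicit Types (p : probability_on R G).

Lemma mass_ge0 p h : 0 <= p h. Proof. by case/andP: (mass_itv p h). Qed.

Lemma mass_l1 p : l1_le p 1.
Proof.
apply/l1norm_leP; rewrite -(mass_sum p) /l1norm.
by apply: le_esum => h _; rewrite ger0_norm// mass_ge0.
Qed.

Lemma mass_concentrated p (e : R) : 0 < e ->
  exists2 s : seq G, uniq s & 1 - e <= \sum_(h <- s) p h.
Proof.
move=> e0; have : ((1 - e)%:E < \esum_(h in [set: G]) (p h)%:E)%E.
  by rewrite mass_sum lte_fin; lra.
move=> /ereal_sup_gt[_ [A [finA _] <-]].
rewrite fsbig_finite//= sumEFin lte_fin => /ltW H.
by exists (fset_set A); first exact: fset_uniq.
Qed.

Lemma probability_of_mass (f : G -> R) :
  (forall h, 0 <= f h) -> l1_le f 1 ->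
  (forall e, 0 < e -> exists2 s : seq G, uniq s & 1 - e <= \sum_(h <- s) f h) ->
  exists p, forall h, p h = f h.
Proof.
move=> f0 f1 fe.
have itv h : 0 <= f h <= 1.
  by rewrite f0 /=; have := f1 [:: h] isT; rewrite big_seq1 ger0_norm.
have fE : (\esum_(h in [set: G]) (f h)%:E = l1norm f)%E.
  by apply: eq_esum => h _; rewrite ger0_norm.
have sum1 : (\esum_(h in [set: G]) (f h)%:E = 1)%E.
  rewrite fE; apply/eqP; rewrite eq_le; apply/andP; split; first exact/l1norm_leP.
  apply/lee_subgt0Pr => e e0; have [s us se] := fe e e0.
  apply: (@le_trans _ _ (\sum_(h <- s) f h)%:E); first by rewrite lee_fin.
  apply: ereal_sup_ubound.
  exists [set` s]; first by split=> //; exact: finite_seq.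
  rewrite fsbig_finite /=; last exact: finite_seq.
  rewrite -sumEFin; under eq_bigr do rewrite ger0_norm//.
  apply: perm_big; apply: uniq_perm; rewrite ?fset_uniq// => x.
  rewrite in_fset_set; last exact: finite_seq.
  by apply/idP/idP => [/set_mem|xs]; last exact/mem_set.
by exists (ProbabilityOn itv sum1).
Qed.

Lemma mixture (m : nat) (w : nat -> R) (P : nat -> probability_on R G) :
  (forall j, 0 <= w j) -> \sum_(j < m) w j = 1 ->
  exists p, forall h, p h = \sum_(j < m) w j * P j h.
Proof.
move=> w0 w1; apply: probability_of_mass.
- by move=> h; apply: sumr_ge0 => j _; rewrite mulr_ge0// mass_ge0.
- apply: (@l1_le_trans _ _ _ (\sum_(j < m) `|w j| * 1)).
    by under eq_bigr do rewrite mulr1 ger0_norm//; rewrite w1.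
  by apply: (@l1_le_sum _ _ _ _ (fun j : 'I_m => w j) (fun j : 'I_m => P j : G -> R)) => j _; exact: mass_l1.
- move=> e e0.
  (* One finite set, a union, must carry almost all the mass of every [P j] at once. *)
  have [s us sP] : exists2 s : seq G, uniq s &
      forall j, (j < m)%N -> 1 - e <= \sum_(h <- s) P j h.
    elim: {w1} m => [|m [s us sP]]; first by exists [::].
    have [s' us' s'P] := mass_concentrated (P m) e0.
    exists (undup (s ++ s')); rewrite ?undup_uniq// => j.
    rewrite ltnS leq_eqVlt => /predU1P[->|jm].
      apply: le_trans s'P _; apply: sum_sub_seq; rewrite ?undup_uniq//.
        exact: mass_ge0.
      by move=> h hs; rewrite mem_undup mem_cat hs orbT.
    apply: le_trans (sP j jm) _; apply: sum_sub_seq; rewrite ?undup_uniq//.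
      exact: mass_ge0.
    by move=> h hs; rewrite mem_undup mem_cat hs.
  exists s => //; rewrite exchange_big /= -[1 - e]mul1r -[X in X * _ <= _]w1 mulr_suml.
  by apply: ler_sum => j _; rewrite -mulr_sumr; apply: ler_wpM2l => //; exact: sP.
Qed.

Lemma l1_le_translate (g : G) (f k : G -> R) (B : R) :
  l1_le (f \- k) B -> l1_le (left_translate g f \- left_translate g k) B.
Proof.
move=> fkB s us.
have := fkB [seq (g^-1 * h)%g | h <- s]; rewrite big_map; apply.
by rewrite map_inj_uniq//; exact: mulgI.
Qed.

Lemma pairingE (f : compactly_supported R G) : exists s : seq G,
  forall p, pairing f p = \sum_(h <- s) sval f h * p h.
Proof.
case: f => f finf; exists (fset_set [set h | f h != 0]) => p.
rewrite /pairing /= (@fsbigTE _ _ _ _ (fset_set [set h | f h != 0]))//.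
move=> h; rewrite in_fset_set// notin_setE /= => /negP.
by rewrite negbK => /eqP ->; rewrite mul0r.
Qed.

Definition point_indicator (h0 : G) : compactly_supported R G.
Proof.
exists (fun h => (h == h0)%:R).
apply: (@sub_finite_set _ _ [set h0]) => // h /= hn.
by apply/eqP; apply: contraNT hn => /negPf ->.
Defined.

Lemma pairing_point (h0 : G) p : pairing (point_indicator h0) p = p h0.
Proof.
rewrite /pairing /= (@fsbigTE _ _ _ _ [fset h0]%fset) /=.
  by rewrite big_seq_fset1 eqxx mul1r.
by move=> h; rewrite inE => /negPf ->; rewrite mul0r.
Qed.

(** The vague topology is that of pointwise convergence: indicators of points are test functions,
    and every pairing is a finite combination of point masses. *)
Lemma continuous_probabilityP (X : topologicalType) (b : X -> probability_on R G) :
  continuous b <-> forall h, continuous (fun x => b x h).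
Proof.
split=> [cb h|cb x].
  have -> : (fun x => b x h) = pairing (point_indicator h) \o b.
    by apply: functional_extensionality_dep => x /=; rewrite pairing_point.
  move=> x; apply: continuous_comp; first exact: cb.
  have /cvg_sup/(_ (point_indicator h)) H : nbhs (b x) --> b x by exact: cvg_id.
  move=> U /(@initial_continuous _ _ (pairing (point_indicator h))) V.
  exact: H V.
apply/cvg_sup => f.
apply: (@continuous_comp_initial _ X R (pairing f)).
have [s sP] := pairingE f.
have -> : pairing f \o b = fun x => \sum_(h <- s) sval f h * b x h.
  by apply: functional_extensionality_dep => y /=; rewrite sP.
apply: continuous_sumr => h; apply: continuous_mulr => //.
exact: cst_continuous.
Qed.

(** Vague continuity upgrades to l1 continuity: by [l1_le_of_finite], closeness at the finitely many
    points carrying almost all of [b x] suffices. Compactness of X then gives a finite net of values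
    of [b]. *)
Lemma l1_net (X : topologicalType) (x0 : X) (b : X -> probability_on R G)
    (e : R) :
  compact [set: X] -> continuous b -> 0 < e ->
  exists (m : nat) (P : nat -> probability_on R G), forall x,
    exists2 j, (j < m)%N & l1_le (b x \- P j) e.
Proof.
move=> cX /continuous_probabilityP cb e0.
have nb x : nbhs x [set y | l1_le (b y \- b x) e].
  have e40 : 0 < e / 4 by lra.
  have [s us se] := mass_concentrated (b x) e40.
  have e's : 0 < e / 4 / (size s).+1%:R by rewrite divr_gt0// ltr0n.
  have fin (r : seq G) : \forall y \near x, forall h, h \in r ->
      `|b y h - b x h| <= e / 4 / (size s).+1%:R.
    elim: r => [|h r IHr]; first by apply: filterE.
    have H := @cvgr_distC_le R R^o X _ _ (fun y => b y h) (b x h) (cb h x) _ e's.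
    apply: filterS2 IHr (H _) => y yr yh k; rewrite inE => /predU1P[->//|]; exact: yr.
  apply: filterS (fin s) => y ys /=.
  rewrite [e](_ : _ = 4 * (e / 4)); last by field.
  apply: (l1_le_of_finite _ _ _ _ us se); try exact: mass_ge0; try exact: mass_l1.
  apply: (@le_trans _ _ (\sum_(h <- s) e / 4 / (size s).+1%:R)).
    by rewrite big_seq [leRHS]big_seq; apply: ler_sum => h /ys.
  rewrite big_const_seq count_predT iter_addr_0 -[_ *+ size s]mulr_natr mulrAC.
  by rewrite ler_pdivrMr ?ltr0n// ler_pM2l// ler_nat.
pose pX : ptopologicalType := HB.pack X (isPointed.Build X x0).
have {}cX : cover_compact [set: pX] by rewrite -compact_cover.
move: cX => /(_ X setT
  (fun x => interior ([set y | l1_le (b y \- b x) e] : set X))) [].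
- by move=> x _; exact: open_interior.
- by move=> x _; exists x => //; exact: nb.
move=> D _ Dcov; exists (size D), (fun j => b (nth x0 D j)) => x.
have [y yD xy] := Dcov x I; exists (index y D).
  by rewrite index_mem.
by rewrite nth_index//; exact: (interior_subset xy).
Qed.

(** The point [x0] makes the supremum nonnegative; over an empty space it would be minus
    infinity. *)
Lemma cvg_sup_l1P (X : topologicalType) (x0 : X) (F : nat -> X -> G -> R) :
  (ereal_sup [set l1norm (F n x) | x in [set: X]] @[n --> \oo] --> (0 : \bar R))
  <-> forall e, 0 < e -> \forall n \near \oo, forall x, l1_le (F n x) e.
Proof.
have supP n e : (ereal_sup [set l1norm (F n x) | x in [set: X]] <= e%:E)%E <->
    forall x, l1_le (F n x) e.
  split=> [H x|H]; last by apply: ge_ereal_sup => _ [x _ <-]; exact/l1norm_leP.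
  apply/l1norm_leP; apply: le_trans H; apply: ereal_sup_ubound.
  by exists x.
have sup0 n : (0 <= ereal_sup [set l1norm (F n x) | x in [set: X]])%E.
  have F0 : (0 <= l1norm (F n x0))%E by apply: esum_ge0.
  by apply: le_trans F0 _; apply: ereal_sup_ubound; exists x0.
split=> [H e e0|H].
  have He : \forall n \near \oo,
      (ereal_sup [set l1norm (F n x) | x in [set: X]] < e%:E)%E.
    exact: (H _ (@nbhs_open_ereal_lt R 0 (fun=> e) e0)).
  by apply: filterS He => n /ltW /supP.
apply/fine_cvgP; split.
  apply: filterS (H 1 ltr01) => n /supP n1.
  by rewrite ge0_fin_numE// (le_lt_trans n1)// ltry.
apply/(@cvgr0Pnorm_le R R^o) => e e0; apply: filterS (H e e0) => n /supP ne /=.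
rewrite ger0_norm ?fine_ge0// -lee_fin fineK//.
by rewrite ge0_fin_numE// (le_lt_trans ne)// ltry.
Qed.

End Probability.

(** * Actions on the Hilbert cube *)

Lemma eq_l1_le (R : realType) (G : eqType) (f g : G -> R) (B : R) :
  f =1 g -> l1_le f B -> l1_le g B.
Proof. by move=> fg fB s us; under eq_bigr do rewrite -fg; exact: fB. Qed.

(** Pulling back along the orbit map of [x0] eliminates X: what remains is, for each [n], a finite
    colouring of G and one measure per colour. *)
Lemma discretize (R : realType) (G : groupType) (X : topologicalType) (x0 : X)
    (act : G -> X -> X) :
  compact [set: X] -> is_action_by_homeomorphisms act -> amenable_action R act ->
  exists (m : nat -> nat) (c : nat -> G -> nat)
      (P : nat -> nat -> probability_on R G),
    (forall n x, (c n x < m n)%N) /\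
    forall g e, 0 < e -> \forall n \near \oo, forall x,
      l1_le (left_translate g (P n (c n x)) \- P n (c n (g * x)%g)) e.
Proof.
move=> cX [_ actM _] [b [cb blim]].
have inv0 n : 0 < n.+1%:R^-1 :> R by rewrite invr_gt0 ltr0n.
have net n : { mPc : nat * (nat -> probability_on R G) * (G -> nat) |
    forall x, (mPc.2 x < mPc.1.1)%N /\
      l1_le (b n (act x x0) \- mPc.1.2 (mPc.2 x)) n.+1%:R^-1}.
  apply: cid; have [m [P mP]] := l1_net x0 cX (cb n) (inv0 n).
  have /choice[c cP] : forall x, exists j,
      (j < m)%N /\ l1_le (b n (act x x0) \- P j) n.+1%:R^-1.
    by move=> x; have [j jm jP] := mP (act x x0); exists j.
  by exists (m, P, c).
exists (fun n => (sval (net n)).1.1), (fun n => (sval (net n)).2),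
  (fun n => (sval (net n)).1.2); split=> [n x|g e e0].
  by case: (svalP (net n) x).
have e4 : 0 < e / 4 by lra.
have /(cvg_sup_l1P x0) bg := blim g.
apply: filterS2 (bg _ e4) (near_infty_natSinv_lt (PosNum e4)) => n bn /= ne x.
have [_ nx] := svalP (net n) x; have [_ ngx] := svalP (net n) (g * x)%g.
have [ne4 e40] := (ltW ne, ltW e4).
(* The path is from the translated net measure to the translate of [b n] at [x x0], then to [b n] at
   [g x x0], then to its net measure; each leg costs at most [e / 4]. *)
have h1 := l1_le_translate g (l1_leC (l1_le_trans ne4 nx)).
have h2 := bn (act x x0); rewrite -actM in h2.
have := l1_leB (l1_leB h1 h2) (l1_le_trans ne4 ngx).
by apply: l1_le_trans; lra.
Qed.

(** Taking positive parts does not increase the distance to the nonnegative [mu], so [U] is within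
    [m * d] of 1, hence positive. Dividing by [U] costs a further [|U - 1|] in total. *)
Lemma normalized_close (R : realType) (m : nat) (y mu : nat -> R) (d : R) :
  (forall j, 0 <= mu j) -> \sum_(j < m) mu j = 1 ->
  (forall j, (j < m)%N -> `|y j - mu j| <= d) -> m%:R * d <= 2^-1 ->
  let u j := Num.max 0 (y j) in let U := \sum_(j < m) u j in
  0 < U /\ \sum_(j < m) `|u j / U - mu j| <= 2 * (m%:R * d).
Proof.
move=> mu0 mu1 ymu md u U.
have umu : \sum_(j < m) `|u j - mu j| <= m%:R * d.
  rewrite -[m in leRHS]card_ord mulr_natl -sumr_const; apply: ler_sum => j _.
  apply: le_trans (ymu j (ltn_ord j)); rewrite /u; have := mu0 j.
  by case: (leP 0 (y j)) => // yj muj; rewrite !ler0_norm; lra.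
have U1 : `|U - 1| <= m%:R * d.
  apply: le_trans umu; rewrite -mu1 -sumrB; exact: ler_norm_sum.
have U0 : 0 < U by move: U1; rewrite ler_norml; lra.
have u0 j : 0 <= u j by rewrite le_max lexx.
split=> //; apply: (@le_trans _ _ (\sum_(j < m) (`|u j - mu j| + u j * `|U^-1 - 1|))).
  apply: ler_sum => j _; rewrite -[X in X * `|_|]ger0_norm// -normrM.
  rewrite (_ : u j / U - mu j = u j - mu j + u j * (U^-1 - 1)); last by ring.
  exact: ler_normD.
rewrite big_split /= -mulr_suml -/U -[X in X * _]gtr0_norm// -normrM.
rewrite mulrBr mulfV ?gt_eqF// mulr1 distrC; lra.
Qed.

Lemma nat_bijection (T : Type) : countable [set: T] -> infinite_set [set: T] ->
  exists (enc : T -> nat) (dec : nat -> T), cancel enc dec /\ cancel dec enc.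
Proof.
move=> cT iT; have /card_set_bijP[f] := eq_card_nat cT iT.
by rewrite setTT_bijective => -[g fg gf]; exists f, g.
Qed.

Lemma cube_action (R : realType) (G : groupType) (m : nat -> nat)
    (c : nat -> G -> nat) (P : nat -> nat -> probability_on R G) :
  countable [set: G] -> (forall n x, (c n x < m n)%N) ->
  (forall g e, 0 < e -> \forall n \near \oo, forall x,
      l1_le (left_translate g (P n (c n x)) \- P n (c n (g * x)%g)) e) ->
  admits_amenable_action R G (hilbert_cube R).
Proof.
move=> cG cm cP.
have [enc [dec [encK decK]]] : exists (enc : nat * nat * G -> nat)
    (dec : nat -> nat * nat * G), cancel enc dec /\ cancel dec enc.
  apply: nat_bijection.
    rewrite -setXTT -setXTT; do 2!apply: countableX => //.
  move=> finS; apply: infinite_nat.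
  have := finite_image (fun s : nat * nat * G => s.1.1) finS.
  apply: sub_finite_set => n _; exists (n, 0%N, 1%g) => //.
pose v (x : G) i := let: (n, j, g) := dec i in c n (g * x)%g == j.
(* Chosen so that [4 * (m n * del n)] is at most [1 / (n + 1)]. It depends on neither the colour nor
   the group element, so shifting coordinates preserves the tolerance. *)
pose del n : R := (4 * (m n).+1%:R * n.+1%:R)^-1.
pose dl i := del (dec i).1.1.
have del0 n : 0 < del n by rewrite invr_gt0 !mulr_gt0 ?ltr0n.
have mdel n : 4 * ((m n)%:R * del n) <= n.+1%:R^-1.
  rewrite /del !invfM; set a := (m n).+1%:R; set k := _%:R^-1.
  have k0 : 0 <= k by rewrite invr_ge0 ler0n.
  have ma : (m n)%:R / a <= 1 by rewrite ler_pdivrMr ?ltr0n// mul1r ler_nat.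
  rewrite [leLHS](_ : _ = (m n)%:R / a * k); first by rewrite ler_piMl.
  by field; rewrite ?pnatr_eq0.
have [Phi [Psi [cPhi cPsi PsiK PsiP PhiK]]] :=
  near_hull_cube (1%g : G) v (fun i => del0 (dec i).1.1).
pose shift g (y : R^oo) : R^oo :=
  fun i => let: (n, j, h) := dec i in y (enc (n, j, (h * g)%g)).
have cshift g : continuous (shift g).
  apply: continuous_into_prod => i; rewrite /shift; case: (dec i) => -[n j] h.
  exact: continuous_coord.
have hullE y (s : seq nat) : (forall n, near_hull v dl n y) ->
    exists l : seq (G * R), [/\ all (fun p => 0 <= p.2) l, \sum_(p <- l) p.2 = 1
      & forall i, i \in s -> `|y i - \sum_(p <- l) p.2 * (v p.1 i)%:R| <= dl i].
  move=> /(_ (\max_(i <- s) i).+1)[l [l0 l1 ly]]; exists l; split=> // i si.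
  by apply: ly; rewrite ltnS; exact: leq_bigmax_seq.
have shiftP g y : (forall n, near_hull v dl n y) ->
    forall n, near_hull v dl n (shift g y).
  move=> yP n.
  pose tr i := let: (k, j, h) := dec i in enc (k, j, (h * g)%g).
  have [l [l0 l1 ly]] := hullE y (map tr (iota 0 n)) yP.
  (* Shifting [v x] by [g] gives [v] at [g x], so the same weights serve on translated points. *)
  exists [seq ((g * p.1)%g, p.2) | p <- l]; split.
  - by rewrite all_map.
  - by rewrite big_map.
  - move=> i lin; rewrite big_map /=.
    have : tr i \in map tr (iota 0 n) by rewrite map_f// mem_iota.
    move=> /ly; rewrite /shift /tr /v /dl; case: (dec i) => -[k j] h /=.
    by rewrite encK /=; under eq_bigr do rewrite -mulgA.
have shift1 y : shift 1%g y = y.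
  apply: functional_extensionality_dep => i; rewrite /shift.
  by case E: (dec i) => [[n j] h]; rewrite mulg1 -E decK.
have shiftM g h y : shift (g * h)%g y = shift g (shift h y).
  apply: functional_extensionality_dep => i; rewrite /shift.
  by case: (dec i) => -[n j] k; rewrite encK mulgA.
(* The shift is transported to the cube. The action laws survive because shifts preserve the
   thickened hull, on which [Psi] inverts [Phi]. *)
pose act g (q : hilbert_cube R) : hilbert_cube R := Phi (shift g (Psi q)).
have Psi_act g q : Psi (act g q) = shift g (Psi q).
  by apply: PhiK; apply: shiftP => n; exact: PsiP.
have act1 q : act 1%g q = q by rewrite /act shift1.
have actM g h q : act (g * h)%g q = act g (act h q).
  by rewrite /act -/(act h q) Psi_act -shiftM.
have cact g : continuous (act g).
  exact: (continuous_compose (continuous_compose cPsi (cshift g)) cPhi).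
exists act; split.
  split=> // g; split=> //; exists (act g^-1%g); split=> // q.
    by rewrite -actM mulVg.
  by rewrite -actM mulgV.
pose u n (y : R^oo) j := Num.max 0 (y (enc (n, j, 1%g))).
pose U n y := \sum_(j < m n) u n y j.
(* The weight that [l], translated by [g], gives to colour [j]: the exact value that coordinate
   [(n, j, g)] approximates. *)
pose mu n g (l : seq (G * R)) j :=
  \sum_(p <- l) p.2 * (c n (g * p.1)%g == j)%:R.
have mu_ge0 n g (l : seq (G * R)) j : all (fun p => 0 <= p.2) l -> 0 <= mu n g l j.
  move=> l0; rewrite /mu big_seq; apply: sumr_ge0 => p pl.
  by rewrite mulr_ge0 ?ler0n//; exact: (allP l0).
have mu_mix n g (l : seq (G * R)) (F : nat -> R) :
    \sum_(j < m n) mu n g l j * F j = \sum_(p <- l) p.2 * F (c n (g * p.1)%g).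
  under eq_bigr do rewrite mulr_suml.
  rewrite exchange_big /=; apply: eq_bigr => p _.
  rewrite (bigD1 (Ordinal (cm n (g * p.1)%g)))//= eqxx mulr1 big1 ?addr0// => j.
  by move=> /negPf jn; rewrite -val_eqE /= eq_sym in jn; rewrite jn mulr0 mul0r.
have mu_sum n g (l : seq (G * R)) : \sum_(p <- l) p.2 = 1 ->
    \sum_(j < m n) mu n g l j = 1.
  move=> l1; have := mu_mix n g l (fun=> 1); under eq_bigr do rewrite mulr1.
  by move=> ->; under eq_bigr do rewrite mulr1.
have close n g (y : R^oo) (l : seq (G * R)) : all (fun p => 0 <= p.2) l ->
    \sum_(p <- l) p.2 = 1 ->
    (forall j, (j < m n)%N -> `|y (enc (n, j, 1%g)) - mu n g l j| <= del n) ->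
    0 < U n y /\
    \sum_(j < m n) `|u n y j / U n y - mu n g l j| <= 2^-1 * n.+1%:R^-1.
  move=> l0 l1 yl; have m4 := mdel n.
  have n1 : n.+1%:R^-1 <= 1 :> R by rewrite invf_le1 ?ltr0n// ler1n.
  have m2 : (m n)%:R * del n <= 2^-1.
    by move: m4 n1; move: (_ * del n) (_.+1%:R^-1) => x k; lra.
  have [|||Uy cl] := @normalized_close R (m n) (fun j => y (enc (n, j, 1%g)))
    (mu n g l) (del n) _ _ _ m2; [|exact: mu_sum|exact: yl|].
    by move=> j; exact: mu_ge0.
  split=> //; apply: le_trans cl _.
  by move: m4; move: (_ * del n) (_.+1%:R^-1) => x k; lra.
(* A single [l] must control the coordinates at 1 and at [g], because the measures at [q] and at
   [act g q] are compared through it. *)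
have close_Psi n g q : exists l : seq (G * R),
    [/\ all (fun p => 0 <= p.2) l, \sum_(p <- l) p.2 = 1,
      forall j, (j < m n)%N -> `|Psi q (enc (n, j, 1%g)) - mu n 1%g l j| <= del n
    & forall j, (j < m n)%N -> `|shift g (Psi q) (enc (n, j, 1%g)) - mu n g l j| <= del n].
  have [l [l0 l1 ly]] := hullE (Psi q)
    (map (fun j => enc (n, j, 1%g)) (iota 0 (m n)) ++
     map (fun j => enc (n, j, g)) (iota 0 (m n))) (PsiP q).
  exists l; split=> // j jm.
    have := ly (enc (n, j, 1%g)); rewrite /dl /v encK; apply.
    by rewrite mem_cat map_f// mem_iota.
  rewrite /shift encK mul1g.
  have := ly (enc (n, j, g)); rewrite /dl /v encK; apply.
  by rewrite mem_cat orbC map_f// mem_iota.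
have Upos n q : 0 < U n (Psi q).
  have [l [l0 l1 ly _]] := close_Psi n 1%g q.
  by have [] := close n 1%g _ l l0 l1 ly.
have /choice[b bE] : forall nq : nat * hilbert_cube R,
    exists p : probability_on R G, forall h, p h = \sum_(j < m nq.1)
      (u nq.1 (Psi nq.2) j / U nq.1 (Psi nq.2)) * P nq.1 j h.
  move=> [n q] /=.
  apply: (@mixture _ _ (m n) (fun j => u n (Psi q) j / U n (Psi q)) (P n)) => [j|].
    by rewrite divr_ge0 ?le_max ?lexx// ltW.
  by rewrite -mulr_suml -/(U n (Psi q)) mulfV ?gt_eqF.
exists (fun n q => b (n, q)); split.
  move=> n; apply/continuous_probabilityP => h.
  rewrite (_ : (fun q => _) = fun q => \sum_(j < m n)
    (u n (Psi q) j / U n (Psi q)) * P n j h); last first.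
    by apply: functional_extensionality_dep => q; rewrite bE.
  have cu j : continuous (fun q => u n (Psi q) j).
    apply: continuous_maxr; first exact: cst_continuous.
    exact: (continuous_compose cPsi (@continuous_coord _ _ _)).
  apply: continuous_sumr => j; apply: continuous_mulr; last exact: cst_continuous.
  apply: continuous_divr => [||q]; [exact: cu | | by rewrite gt_eqF].
  by apply: continuous_sumr => k; exact: cu.
move=> g; apply/(cvg_sup_l1P (Phi (fun=> 0))).
move=> e e0; have e2 : 0 < e / 2 by lra.
apply: filterS2 (cP g _ e2) (near_infty_natSinv_lt (PosNum e2)) => n Pn /= ne q.
have [l [l0 l1 ly ly']] := close_Psi n g q.
have [_ cl] := close n 1%g _ l l0 l1 ly.
have [_ cl'] := close n g _ l l0 l1 ly'.
(* [M k] is the exact mixture for the combination translated by [k]. The comparison passes through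
   the translate of [M 1] and [M g]; the two ends cost [1 / (n + 1)] together, the middle
   [e / 2]. *)
pose M k : G -> R := fun h => \sum_(p <- l) p.2 * P n (c n (k * p.1)%g) h.
have near k y p : (forall h, p h = \sum_(j < m n) (u n y j / U n y) * P n j h) ->
    \sum_(j < m n) `|u n y j / U n y - mu n k l j| <= 2^-1 * n.+1%:R^-1 ->
    l1_le (p \- M k) (2^-1 * n.+1%:R^-1).
  move=> pE clk.
  have := @l1_le_sum R G _ (index_enum 'I_(m n))
    (fun j => u n y j / U n y - mu n k l j) (fun j => P n j) (fun=> 1).
  move=> /(_ (fun j _ => @mass_l1 R G (P n j))) H.
  apply: (@eq_l1_le _ _ (fun h => \sum_(j < m n)
    (u n y j / U n y - mu n k l j) * P n j h)).
    move=> h; rewrite /= pE /M -(mu_mix n k l (fun j => P n j h)) -sumrB.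
    by apply: eq_bigr => j _; rewrite mulrBl.
  by apply: l1_le_trans H; under eq_bigr do rewrite mulr1.
have h1 := l1_le_translate g (near 1%g _ (b (n, q)) (bE (n, q)) cl).
have h3 : l1_le (b (n, act g q) \- M g) (2^-1 * n.+1%:R^-1).
  by apply: (near g (shift g (Psi q))) => // h; rewrite bE /= Psi_act.
(* The difference is a convex combination, over the points of [l], of the differences bounded by
   [cP] uniformly in the point. *)
have h2 : l1_le (left_translate g (M 1%g) \- M g) (e / 2).
  have := @l1_le_sum R G _ l (fun p => p.2)
    (fun p => left_translate g (P n (c n p.1)) \- P n (c n (g * p.1)%g)) (fun=> e / 2).
  move=> /(_ (fun p _ => Pn p.1)) H.
  apply: (@eq_l1_le _ _ (fun h => \sum_(p <- l) p.2 *
     (left_translate g (P n (c n p.1)) \- P n (c n (g * p.1)%g)) h)).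
    move=> h; rewrite /M /left_translate /= -sumrB; apply: eq_bigr => p _.
    by rewrite mul1g mulrBr.
  apply: l1_le_trans H; rewrite -mulr_suml -[leRHS]mul1r ler_wpM2r ?(ltW e2)//.
  rewrite -l1 big_seq [leRHS]big_seq; apply: ler_sum => p pl.
  by rewrite ger0_norm//; exact: (allP l0).
have := l1_leB (l1_leB h1 h2) (l1_leC h3).
by apply: l1_le_trans; move: ne; move: (_.+1%:R^-1) => k ne; lra.
Qed.

(** * Compactness and separation of the Hilbert cube *)

Lemma unit_interval_compact (R : realType) :
  compact [set: set_type `[0 : R, 1]%classic].
Proof.
pose f (t : R) : set_type `[0 : R, 1]%classic := SigSub (clamp_itv t).
have -> : [set: set_type `[0 : R, 1]%classic] = [set f t | t in `[0, 1]%classic].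
  apply/seteqP; split=> // x _; exists (set_val x); first exact: set_valP.
  apply: val_inj; rewrite set_valE /= clamp_id//.
  by have := set_valP x; rewrite /= in_itv.
apply: continuous_compact; last exact: segment_compact.
apply: continuous_subspaceT; apply: continuous_into_subset.
exact: continuous_clamp.
Qed.

Lemma hausdorff_of_separating (X Y : topologicalType) (I : Type)
    (f : I -> X -> Y) :
  hausdorff_space Y -> (forall i, continuous (f i)) ->
  (forall p q, (forall i, f i p = f i q) -> p = q) -> hausdorff_space X.
Proof.
move=> hY cf sep p q pq; apply: sep => i; apply: hY => A B fpA fqB.
have [x [Ax Bx]] := pq _ _ (cf i p _ fpA) (cf i q _ fqB).
by exists (f i x).
Qed.

Lemma hilbert_cube_compact (R : realType) : compact [set: hilbert_cube R].
Proof.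
rewrite (_ : [set: hilbert_cube R] = [set f : hilbert_cube R | forall i, setT (f i)]).
  exact: (@tychonoff nat _ _ (fun=> @unit_interval_compact R)).
by apply/seteqP; split.
Qed.

Lemma hilbert_cube_hausdorff (R : realType) : hausdorff_space (hilbert_cube R).
Proof.
apply: (@hausdorff_of_separating (hilbert_cube R) R nat
  (fun n (q : hilbert_cube R) => set_val (q n) : R)).
- exact: Rhausdorff.
- move=> n; apply: (@continuous_compose _ _ _ (fun q : hilbert_cube R => q n) set_val).
    exact: continuous_coord.
  exact: initial_continuous.
- move=> p q pq; apply: functional_extensionality_dep => n; apply: val_inj.
  by have := pq n; rewrite set_valE.
Qed.

Theorem mainTheorem5 (R : realType) (G : groupType)
    (countableG : countable [set: G]) :
  amenable_at_infinity R G <-> admits_amenable_action R G (hilbert_cube R).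
Proof.
split=> [[X [[x0 _] cX _ [act [actX amX]]]]|amQ].
  have [m [c [P [cm cP]]]] := discretize x0 cX actX amX.
  exact: (cube_action countableG cm cP).
exists (hilbert_cube R); split=> //.
- by exists (fun=> SigSub (clamp_itv (0 : R))).
- exact: hilbert_cube_compact.
- exact: hilbert_cube_hausdorff.
Qed.
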